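(* For every integer $k\ge 1$, as $d\to\infty$, $$\log_2 K(d,k)=d+O(\log^2 d),$$ where the implied constant depends only on $k$. In particular the limit $\nu(k):=\lim_{d\to\infty}\frac{\log_2 K(d,k)}{d}$ exists and $\nu(k)=1$.
   Context: Let $I(d)$ denote the graph of the $d$-dimensional hypercube (vertices are binary vectors of length $d$, adjacent when they differ in exactly one coordinate). For an integer $k\ge 1$, a $(d,k)$ circuit code (circuit code of spread $k$) is a simple cycle $C$ in $I(d)$ such that $d_{I(d)}(x,y)\ge \min\{d_C(x,y),k\}$ for all vertices $x,y$ of $C$, where $d_{I(d)}$ is the graph distance in $I(d)$ (Hamming distance) and $d_C$ is the graph distance along the cycle $C$. $K(d,k)$ denotes the maximum length (number of vertices) of a $(d,k)$ circuit code. *)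

(* Defs.v *)
From HB Require Import structures.
From mathcomp Require Import all_boot all_order all_algebra.
From mathcomp Require Import all_classical all_reals all_analysis.
Import Order.TTheory GRing.Theory Num.Theory.
Import numFieldNormedType.Exports.

Set Implicit Arguments.
Unset Strict Implicit.
Unset Printing Implicit Defensive.

(* The least n such that e has a walk with n edges from x to y.  As a shortest
   walk has fewer than #|T| edges, it suffices to search n = 0, ..., #|T| - 1;
   the value is #|T| when y is not reachable from x. *)
Definition graph_dist (T : finType) (e : rel T) (x y : T) : nat :=
  find (fun n => [exists p : n.-tuple T, path e x p && (last x p == y)])
       (iota 0 #|T|).

Definition cube (d : nat) : finType := d.-tuple bool.

Definition cube_adj (d : nat) : rel (cube d) :=
  fun x y => #|[set i : 'I_d | tnth x i != tnth y i]| == 1.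

(* A simple cycle is listed by its vertices in cyclic order, without repeating
   the first one.  The size bound is needed because cycle e c and uniq c also
   hold for the empty list and, when e is symmetric, for the two ends of an
   edge. *)
Definition simple_cycle (T : eqType) (e : rel T) (c : seq T) : bool :=
  [&& 2 < size c, uniq c & cycle e c].

Definition cycle_adj (T : eqType) (c : seq T) : rel T :=
  fun x y => [&& x \in c, y \in c & (next c x == y) || (next c y == x)].

Definition circuit_code (d k : nat) (c : seq (cube d)) : bool :=
  simple_cycle (@cube_adj d) c &&
  [forall x in c, forall y in c,
     minn (graph_dist (cycle_adj c) x y) k <= graph_dist (@cube_adj d) x y].

(* The maximum is over the lengths n <= #|cube d|, which every duplicate-free
   list of vertices satisfies; it is 0 if there is no circuit code. *)
Definition K (d k : nat) : nat :=
  \max_(n < #|cube d|.+1 | [exists c : n.-tuple (cube d), circuit_code k c]) n.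

Local Open Scope ring_scope.

Definition log2 (R : realType) (x : R) : R := ln x / ln 2.

Definition nu (R : realType) (k : nat) : R :=
  limn (fun d : nat => log2 (K d k)%:R / d%:R : R).

(* Main.v *)
(* Put the vertices of the (m+1)-cube in Gray code order g, and color them with
   2 ^ l = poly(m) colors so that distinct vertices at distance at most k + 1
   differ in color.  Next to the m + 1 coordinates of x, carry L = 3 k l pairs
   of coordinates: each pair records one bit of the color of x, and its second
   member is twisted by the parity of x so that one step of g changes exactly
   one member.  The bits are repeated so that any of three groups of k l
   consecutive pairs contains the whole color k times.  Now update the L + 1
   blocks of coordinates cyclically, one at a time: with M = L + 1, block j at
   time t shows g ((t + j) / M).
   Two times at distance i <= M differ in exactly i coordinates.  For two times
   further apart, one of the three groups is in neither case being updated, so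
   it shows the color of some g a and of some g b with g a <> g b: if these
   colors differ, k pairs differ, and otherwise g a and g b are so far apart that
   the coordinates of x alone differ in k places.
   Hence log2 K(d, k) >= d - 6 k l with l = O(log d), while K(d, k) <= 2 ^ d. *)

Require Import Defs.
From mathcomp Require Import all_boot all_order all_algebra.
From mathcomp Require Import all_classical all_reals all_analysis.
From mathcomp Require Import zify.
Import Order.TTheory GRing.Theory Num.Theory.
Import numFieldNormedType.Exports.

Set Implicit Arguments.
Unset Strict Implicit.
Unset Printing Implicit Defensive.
Local Open Scope nat_scope.

(** * Hamming distance of Boolean functions *)

Definition hamming (Q : finType) (f g : Q -> bool) : nat := \sum_q (f q != g q).

Section Hamming.
Variable Q : finType.
Implicit Types f g h : Q -> bool.

Lemma hamming_eq0 f g : hamming f g = 0 -> f =1 g.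
Proof.
move=> /eqP; rewrite sum_nat_eq0 => /forallP fg q.
by have := fg q; rewrite /= eqb0 negbK => /eqP.
Qed.

Lemma hammingxx f : hamming f f = 0.
Proof. by rewrite /hamming big1 // => q _; rewrite eqxx. Qed.

Lemma hammingC f g : hamming f g = hamming g f.
Proof. by apply: eq_bigr => q _; rewrite eq_sym. Qed.

Lemma hamming_triangle g f h : hamming f h <= hamming f g + hamming g h.
Proof.
rewrite /hamming -big_split; apply: leq_sum => q _.
by case: (f q) (g q) (h q) => [] [] [].
Qed.

Lemma hamming_card f g : hamming f g = #|[set q | f q != g q]%SET|.
Proof.
rewrite /hamming cardsE -sum1_card [RHS]big_mkcond.
by apply: eq_bigr => q _; rewrite unfold_in /=; case: (_ != _).
Qed.

Lemma leq_hamming_inj (k : nat) (h : 'I_k -> Q) f g :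
  injective h -> (forall r, f (h r) != g (h r)) -> k <= hamming f g.
Proof.
move=> h_inj fg; rewrite hamming_card -[k in k <= _]card_ord -(card_codom h_inj).
by apply/subset_leq_card/fintype.subsetP => _ /codomP[r ->]; rewrite inE.
Qed.

Lemma odd_hamming f g :
  odd (hamming f g) = odd (\sum_q f q) (+) odd (\sum_q g q).
Proof.
rewrite -oddD -big_split /= /hamming.
elim/big_ind2: _ => // [a a' b b' | q _]; first by rewrite !oddD => -> ->.
by case: (f q) (g q) => [] [].
Qed.

End Hamming.

Lemma next_nth_modn (T : eqType) (c : seq T) (x0 : T) (n : nat) :
  uniq c -> 0 < size c ->
  next c (nth x0 c (n %% size c)) = nth x0 c (n.+1 %% size c).
Proof.
move=> uc c0; have rc : n %% size c < size c by rewrite ltn_mod.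
rewrite next_nth mem_nth // index_uniq // -[n.+1]addn1 -modnDml addn1.
case: c rc {uc c0} => [|y c] //=; move: (n %% _) => r.
rewrite ltnS leq_eqVlt => /predU1P[->|rc].
  (* Past the tail, [next] defaults to the head, which is also the entry at the wrapped index 0. *)
  by rewrite modnn nth_default.
by rewrite modn_small ?ltnS //=; apply: set_nth_default.
Qed.

(** * Gray codes *)

Section Gray.

Definition bcons (m : nat) (b : bool) (x : {ffun 'I_m -> bool}) :
    {ffun 'I_m.+1 -> bool} :=
  [ffun i => if unlift ord0 i is Some j then x j else b].

Lemma bcons0 m b (x : {ffun 'I_m -> bool}) : bcons b x ord0 = b.
Proof. by rewrite ffunE unlift_none. Qed.

Lemma bcons_lift m b (x : {ffun 'I_m -> bool}) j : bcons b x (lift ord0 j) = x j.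
Proof. by rewrite ffunE liftK. Qed.

Lemma bcons_inj m b : injective (@bcons m b).
Proof.
by move=> x y xy; apply/ffunP => j; rewrite -(bcons_lift b x) xy bcons_lift.
Qed.

Lemma hamming_bcons m b c (x y : {ffun 'I_m -> bool}) :
  hamming (bcons b x) (bcons c y) = (b != c) + hamming x y.
Proof.
rewrite /hamming big_ord_recl !bcons0; congr addn.
by apply: eq_bigr => j _; rewrite !bcons_lift.
Qed.

Definition hadj (m : nat) : rel {ffun 'I_m -> bool} :=
  fun x y => hamming x y == 1.

Lemma hadjC m : symmetric (@hadj m).
Proof. by move=> x y; rewrite /hadj hammingC. Qed.

(** Reflected Gray code: the second copy runs backwards, so at both seams only the prepended bit
    changes. *)
Lemma gray_step m (x : {ffun 'I_m -> bool}) s :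
  path (@hadj m) x s -> uniq (x :: s) ->
  let c := [seq bcons false y | y <- x :: s]
           ++ rev [seq bcons true y | y <- x :: s] in
  [/\ size c = (size s).+1.*2, uniq c & cycle (@hadj m.+1) c].
Proof.
move=> xs uxs c; split; rewrite {}/c.
- by rewrite size_cat size_rev !size_map addnn.
- rewrite cat_uniq rev_uniq !map_inj_uniq ?uxs ?andbT /=; [|exact: bcons_inj..].
  apply/hasPn => z; rewrite mem_rev -!map_cons => /mapP[y _ ->]; apply/mapP; case=> y1 _.
  by move=> /ffunP/(_ ord0); rewrite !bcons0.
have P b : path (@hadj m.+1) (bcons b x) [seq bcons b y | y <- s].
  by rewrite path_map; apply: sub_path xs => y z; rewrite /= /hadj hamming_bcons eqxx.
have -> : rev [seq bcons true y | y <- x :: s]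
    = bcons true (last x s) :: rev (belast (bcons true x) [seq bcons true y | y <- s]).
  by rewrite /= lastI rev_rcons last_map.
rewrite /= rcons_cat cat_path P last_map /=.
rewrite {1}/hadj hamming_bcons hammingxx /= -(last_map (bcons true)) rcons_path.
rewrite (@eq_path _ (@hadj m.+1) (fun z => (@hadj m.+1)^~ z)); last exact: hadjC.
rewrite rev_path P /=.
have -> : last (last (bcons true x) [seq bcons true y | y <- s])
    (rev (belast (bcons true x) [seq bcons true y | y <- s])) = bcons true x.
  by case: (s) => [|y s'] //=; rewrite rev_cons last_rcons.
by rewrite /hadj hamming_bcons hammingxx.
Qed.

(** The induction carries a path: the reflection step consumes one, and its cycle gives one again
    once the closing edge is dropped. *)
Lemma gray_path m : exists x s,
  [/\ (size s).+1 = 2 ^ m, uniq (x :: s) & path (@hadj m) x s].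
Proof.
elim: m => [|m [x [s [sz us xs]]]]; first by exists [ffun=> true], [::].
have [] := gray_step xs us; set c := (_ ++ _).
case Ec : c => [|y c'] // szc uc; rewrite /= rcons_path => /andP[yc' _].
by exists y, c'; split => //; rewrite expnS mul2n -sz -szc.
Qed.

Lemma gray_cycle m : exists g : nat -> {ffun 'I_m.+1 -> bool},
  [/\ forall n, g (n + 2 ^ m.+1) = g n,
      forall a b, a < b < a + 2 ^ m.+1 -> g a != g b
    & forall n, hamming (g n) (g n.+1) = 1].
Proof.
have [x [s [sz us xs]]] := gray_path m.
have [] := gray_step xs us; set c := (_ ++ _) => szc uc cc.
rewrite {}sz -mul2n -expnS in szc.
pose x0 := head [ffun=> true] c; set N := 2 ^ _ in szc *.
have N0 : 0 < N by rewrite expn_gt0.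
exists (fun n => nth x0 c (n %% N)); split => [n|a b ab|n].
- by rewrite modnDr.
- have /andP[ltab ltbN] := ab.
  rewrite nth_uniq ?szc ?ltn_mod // eq_sym eqn_mod_dvd 1?ltnW //.
  by rewrite gtnNdvd ?subn_gt0 // ltn_subLR // ltnW.
- rewrite -szc -next_nth_modn ?szc //; apply/eqP; apply: next_cycle cc _.
  by rewrite mem_nth // szc ltn_mod.
Qed.

End Gray.

(** * Greedy coloring and the size of Hamming balls *)

Section Coloring.

(** Vertices are colored one by one; the neighbors of the next vertex occupy fewer than [#|C|]
    colors. *)
Lemma greedy_coloring (X C : finType) (e : rel X) :
  symmetric e -> irreflexive e -> (forall x, #|[set y | e x y]%SET| < #|C|) ->
  exists chi : X -> C, forall x y, e x y -> chi x != chi y.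
Proof.
move=> e_sym e_irr degC.
suff [chi chiP] : exists chi : X -> C,
    {in enum X &, forall x y, e x y -> chi x != chi y}.
  by exists chi => x y; apply: chiP; rewrite mem_enum.
(* [C] may be empty when [X] is; a vertex of [X] forces a default color to exist. *)
have [x0 _ | X0] := pickP (@predT X); last first.
  have chi0 (x : X) : C by have := X0 x.
  by exists chi0 => x; have := X0 x.
have /card_gt0P[c0 _] : 0 < #|C| by apply: leq_ltn_trans (degC x0).
elim: (enum X) => [|z s [chi IH]]; first by exists (fun=> c0).
pose used := (chi @: [set y | e z y])%SET.
have /card_gt0P[c cP] : 0 < #|(~: used)%SET|.
  rewrite -(ltn_add2l #|used|) addn0 cardsC.
  exact: leq_ltn_trans (leq_imset_card _ _) (degC z).
have cN y : e z y -> c != chi y.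
  move=> zy; apply: contraTneq cP => ->; rewrite inE negbK.
  by apply: imset_f; rewrite inE.
exists (fun y => if y == z then c else chi y) => x y.
rewrite !inE; case: (eqVneq x z) => [-> _|_ /= xs]; case: (eqVneq y z) => [->|_ /=].
- by rewrite e_irr.
- by move=> _ /cN.
- by rewrite e_sym eq_sym => _ /cN.
- exact: IH.
Qed.

Variable m : nat.
Implicit Types x y : {ffun 'I_m -> bool}.

Definition ball (T : nat) x := [set y : {ffun 'I_m -> bool} | hamming x y <= T]%SET.

(** [None] changes nothing, so the m + 1 options index [x] together with its neighbors. *)
Definition toggle (o : option 'I_m) x : {ffun 'I_m -> bool} :=
  [ffun i => x i (+) (o == Some i)].

(** Balls of radius T around [x] and its neighbors cover the ball of radius T + 1: flip a coordinate
    where the point differs from [x]. *)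
Lemma leq_card_ball (T : nat) x : #|ball T x| <= m.+1 ^ T.
Proof.
elim: T x => [|T IH] x.
  rewrite expn0 -(cards1 x); apply/subset_leq_card/fintype.subsetP => y.
  rewrite !inE leqn0 => /eqP/hamming_eq0 xy; apply/eqP/ffunP => i.
  by rewrite xy.
have sub : (ball T.+1 x \subset \bigcup_(o : option 'I_m) ball T (toggle o x))%SET.
  apply/fintype.subsetP => y; rewrite inE => xyT; apply/bigcupP.
  have [i xyi | xy] := pickP (fun i => x i != y i); last first.
    exists None => //; rewrite inE /hamming big1 // => i _.
    by rewrite ffunE addbF xy.
  exists (Some i) => //; rewrite inE; move: xyT.
  rewrite /hamming (bigD1 i) // [X in _ -> X <= _](bigD1 i) //= xyi !ffunE eqxx.
  have -> : (x i (+) true != y i) = false by move: xyi; case: (x i) (y i) => [] [].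
  rewrite add1n ltnS add0n; apply: leq_trans.
  by apply: leq_sum => j ji; rewrite ffunE (inj_eq Some_inj) (eq_sym i) (negPf ji) addbF.
apply: leq_trans (subset_leq_card sub) _.
apply: (@leq_trans (\sum_(o : option 'I_m) #|ball T (toggle o x)|)).
  elim/big_ind2: _ => [|A a B b Aa Bb|//]; first by rewrite cards0.
  by apply: leq_trans (leq_card_setU _ _) (leq_add Aa Bb).
have cm : #|{: option 'I_m}| = m.+1 by rewrite card_option card_ord.
rewrite expnS -[X in X * _]cm -sum_nat_const.
by apply: leq_sum => o _; apply: IH.
Qed.

End Coloring.

(** * Graph distance and Hamming distance *)

Lemma graph_dist_le (T : finType) (e : rel T) x p :
  path e x p -> graph_dist e x (last x p) <= size p.
Proof.
move=> xp; rewrite leqNgt; apply/negP => lt_find.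
have szp : size p < #|T|.
  by apply: leq_trans lt_find _; rewrite (leq_trans (find_size _ _)) ?size_iota.
have := before_find 0 lt_find; rewrite nth_iota // add0n => /existsP[].
by exists (in_tuple p); rewrite xp eqxx.
Qed.

Lemma graph_dist_path (T : finType) (e : rel T) x y :
  graph_dist e x y < #|T| ->
  exists p, [/\ path e x p, last x p = y & size p = graph_dist e x y].
Proof.
rewrite /graph_dist; set P := (fun n => _) => lt_find.
have hasP : has P (iota 0 #|T|) by rewrite has_find size_iota.
have := nth_find 0 hasP; rewrite nth_iota // add0n => /existsP[p /andP[xp /eqP xpy]].
by exists p; rewrite size_tuple.
Qed.

Lemma hamming_path d (x : cube d) p :
  path (@cube_adj d) x p -> hamming (tnth x) (tnth (last x p)) <= size p.
Proof.
elim: p x => [|y p IH] x /=; first by rewrite hammingxx.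
case/andP; rewrite /cube_adj -hamming_card => /eqP xy /IH yp.
by apply: leq_trans (hamming_triangle (tnth y) _ _) _; rewrite xy.
Qed.

Lemma hamming_le_graph_dist d (x y : cube d) :
  hamming (tnth x) (tnth y) <= graph_dist (@cube_adj d) x y.
Proof.
have [/graph_dist_path[p [xp <- <-]]|] := ltnP (graph_dist (@cube_adj d) x y) #|cube d|.
  exact: hamming_path.
(* Here the graph distance is at least 2 ^ d, which exceeds the number d of coordinates. *)
apply: leq_trans; rewrite card_tuple card_bool hamming_card.
by rewrite (leq_trans (max_card _)) // card_ord ltnW // ltn_expl.
Qed.

Section Transport.
Variables (Q : finType) (f g : Q -> bool).

Definition to_cube (f : Q -> bool) : cube #|Q| := [tuple f (enum_val i) | i < #|Q|].

Lemma hamming_to_cube : hamming (tnth (to_cube f)) (tnth (to_cube g)) = hamming f g.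
Proof.
rewrite /hamming (reindex (@enum_val Q predT)) /=.
  by apply: eq_big => [i|i _]; rewrite ?tnth_mktuple.
by exists enum_rank => q _; [apply: enum_valK|apply: enum_rankK].
Qed.

End Transport.

(** * Periodic sequences as cycles *)

Section Cycle.
Variables (T : finType) (V : nat -> T) (N : nat).
Hypothesis N_gt0 : 0 < N.
Hypothesis V_per : forall t, V (t + N) = V t.
Let c := mkseq V N.
Hypothesis c_uniq : uniq c.

Lemma V_modn t : V t = nth (V 0) c (t %% N).
Proof.
rewrite nth_mkseq ?ltn_mod // {1}(divn_eq t N) addnC.
elim: (t %/ N) => [|q IH]; first by rewrite mul0n addn0.
by rewrite mulSn addnCA addnC V_per.
Qed.

Lemma V_in t : V t \in c.
Proof. by rewrite V_modn mem_nth ?size_mkseq ?ltn_mod. Qed.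

Lemma next_V t : next c (V t) = V t.+1.
Proof.
have sz : size c = N by rewrite size_mkseq.
by rewrite (V_modn t) (V_modn t.+1) -sz next_nth_modn ?sz.
Qed.

Lemma cycle_V (e : rel T) : (forall t, e (V t) (V t.+1)) -> cycle e c.
Proof.
rewrite /c; case: N N_gt0 V_per => // n _ Vp eV; rewrite /mkseq /=.
have -> : rcons [seq V i | i <- iota 1 n] (V 0) = [seq V i | i <- iota 1 n.+1].
  by rewrite -[n.+1]addn1 iotaD map_cat cats1 add1n -(Vp 0).
by elim: n.+1 0 => //= k IH t; rewrite eV IH.
Qed.

Lemma graph_dist_fwd t i : graph_dist (cycle_adj c) (V t) (V (t + i)) <= i.
Proof.
suff [p [pP lp sp]] : exists p,
    [/\ path (cycle_adj c) (V t) p, last (V t) p = V (t + i) & size p = i].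
  by have := graph_dist_le pP; rewrite lp sp.
elim: i t => [|i IH] t; first by exists [::]; rewrite addn0.
have [p [pP lp sp]] := IH t.+1; exists (V t.+1 :: p); rewrite /= lp sp addSnnS.
by split=> //; rewrite pP /cycle_adj !V_in next_V eqxx.
Qed.

Lemma graph_dist_bwd t i : graph_dist (cycle_adj c) (V (t + i)) (V t) <= i.
Proof.
suff [p [pP lp sp]] : exists p,
    [/\ path (cycle_adj c) (V (t + i)) p, last (V (t + i)) p = V t & size p = i].
  by have := graph_dist_le pP; rewrite lp sp.
elim: i => [|i [p [pP lp sp]]]; first by exists [::]; rewrite addn0.
exists (V (t + i) :: p); rewrite /= lp sp addnS.
by split=> //; rewrite pP /cycle_adj !V_in (next_V (t + i)) eqxx orbT.
Qed.

(** Both arcs are walked, the second one from [V (s + i)] on to [V (s + N)], which is [V s]. The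
    maximum over both directions lets [leq_K] treat only s <= t. *)
Lemma graph_dist_cycle s i : i <= N ->
  maxn (graph_dist (cycle_adj c) (V s) (V (s + i)))
       (graph_dist (cycle_adj c) (V (s + i)) (V s)) <= minn i (N - i).
Proof.
move=> iN; rewrite leq_min !geq_max graph_dist_fwd graph_dist_bwd /=.
have -> : V s = V (s + i + (N - i)) by rewrite -addnA subnKC // V_per.
by rewrite graph_dist_fwd graph_dist_bwd.
Qed.

End Cycle.

(** The cycle distance of two times i apart is at most min(i, N - i), so the last hypothesis gives
    the spread; as it is positive for 0 < i < N, it also makes the vertices distinct. *)
Lemma leq_K (Q : finType) (k N : nat) (pos : nat -> Q -> bool) :
  0 < k -> 2 < N ->
  (forall t, pos (t + N) =1 pos t) ->
  (forall t, hamming (pos t) (pos t.+1) = 1) ->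
  (forall s i, i <= N -> minn (minn i (N - i)) k <= hamming (pos s) (pos (s + i))) ->
  N <= K #|Q| k.
Proof.
move=> k_gt0 N_gt2 pos_per pos_adj pos_dist.
have N_gt0 : 0 < N by lia.
pose V t := to_cube (pos t); pose c := mkseq V N.
have V_per t : V (t + N) = V t by apply: eq_mktuple => i; apply: pos_per.
have c_uniq : uniq c.
  suff neq s t : s < t -> t < N -> V s != V t.
    apply/mkseq_uniqP => s t; rewrite !inE => sN tN Vst.
    case: (ltngtP s t) => // [st|ts]; first by have := neq s t st tN; rewrite Vst eqxx.
    by have := neq t s ts sN; rewrite Vst eqxx.
  move=> st tN; apply/eqP => Vst; have := pos_dist s (t - s).
  rewrite (subnKC (ltnW st)) -hamming_to_cube -/(V s) -/(V t) Vst hammingxx; lia.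
have cP : circuit_code k c.
  rewrite /circuit_code /simple_cycle size_mkseq N_gt2 c_uniq /=.
  rewrite cycle_V //=; last first.
    by move=> t; rewrite /cube_adj -hamming_card hamming_to_cube pos_adj.
  have main s t : s <= t -> t < N ->
      minn (maxn (graph_dist (cycle_adj c) (V s) (V t))
                 (graph_dist (cycle_adj c) (V t) (V s))) k
      <= hamming (tnth (V s)) (tnth (V t)).
    move=> st tN; rewrite hamming_to_cube.
    have iN : t - s <= N by lia.
    have := graph_dist_cycle N_gt0 V_per c_uniq s iN.
    have := pos_dist s _ iN; rewrite subnKC // -/c; lia.
  apply/forall_inP => x /mapP[s + ->]; rewrite mem_iota add0n => /= sN.
  apply/forall_inP => y /mapP[t + ->]; rewrite mem_iota add0n => /= tN.
  apply: leq_trans (hamming_le_graph_dist _ _).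
  have [st|/ltnW ts] := leqP s t.
    apply: leq_trans (main s t st tN).
    by rewrite leq_min !geq_min leqnn orbT andbT leq_maxl.
  rewrite hammingC; apply: leq_trans (main t s ts sN).
  by rewrite leq_min !geq_min leqnn orbT andbT leq_maxr.
have N_card : N < #|cube #|Q| |.+1.
  by rewrite ltnS -(size_mkseq V N) -/c -(card_uniqP c_uniq) max_card.
rewrite /K; apply: (@leq_bigmax_cond _ _
  (fun n : 'I_#|cube #|Q| |.+1 => n : nat) (Ordinal N_card)) => /=.
by apply/existsP; exists (Tuple (introT eqP (size_mkseq V N))).
Qed.

(* Hermite's identity. *)
Lemma sum_divnD (M n : nat) : 0 < M -> \sum_(j < M) ((n + j) %/ M) = n.
Proof.
case: M => // M _; elim: n => [|n IH].
  by rewrite big1 // => j _; rewrite add0n divn_small.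
(* One extra term is summed: dropping the last leaves the sum for [n], dropping the first leaves the
   sum for [n.+1], and the dropped terms differ by 1. *)
have : \sum_(j < M.+2) (n + j) %/ M.+1 = n + (n + M.+1) %/ M.+1.
  by rewrite big_ord_recr /= IH.
rewrite big_ord_recl [X in _ = n + X]divnDr // divnn addn0 [RHS]addnCA => /addnI.
rewrite addn1 => E; rewrite -[RHS]E.
by apply: eq_bigr => j _; rewrite lift0 addSnnS.
Qed.

Lemma divnDd (d n : nat) : 0 < d -> (n + d) %/ d = (n %/ d).+1.
Proof. by move=> d_gt0; rewrite divnDr // divnn d_gt0 addn1. Qed.

(** * The block construction *)

Section Construction.

Variables (m k l : nat).
Hypothesis k_gt0 : 0 < k.
Hypothesis l_gt0 : 0 < l.

Local Notation X := {ffun 'I_m.+1 -> bool}.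
Local Notation L := (3 * (k * l)).
Local Notation M := L.+1.

Variable g : nat -> X.
Hypothesis g_per : forall n, g (n + 2 ^ m.+1) = g n.
Hypothesis g_inj : forall a b, a < b < a + 2 ^ m.+1 -> g a != g b.
Hypothesis g_adj : forall n, hamming (g n) (g n.+1) = 1.

Variable chi : X -> l.-tuple bool.
Hypothesis chiP : forall x y : X, x != y -> hamming x y <= k.+1 -> chi x != chi y.

Local Notation Q := ('I_m.+1 + 'I_L * bool)%type.

(* Exactly one of the two coordinates [inr (o, _)] changes along an edge. *)
Definition feature (x : X) (q : Q) : bool :=
  match q with
  | inl i => x i
  | inr (o, b) => nth false (chi x) (o %% l) (+) (b && odd (\sum_i x i))
  end.

Definition phase (q : Q) : nat := if q is inr (o, _) then o.+1 else 0.

Definition pos (t : nat) (q : Q) : bool := feature (g ((t + phase q) %/ M)) q.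

Let M_gt0 : 0 < M. Proof. by []. Qed.

Lemma hamming_gray_window a b : a <= b <= a.+1 -> hamming (g a) (g b) = b - a.
Proof.
rewrite [b <= a.+1]leq_eqVlt ltnS => /andP[ab /predU1P[->|ba]].
  by rewrite g_adj subSnn.
by have -> : a = b by [lia]; rewrite hammingxx subnn.
Qed.

(** A Gray step flips the parity of the vertex. Hence the plain member changes if the color bit
    does, and the twisted member changes if it does not. *)
Lemma feature_window a b o : a <= b <= a.+1 ->
  \sum_(c : bool) (feature (g a) (inr (o, c)) != feature (g b) (inr (o, c))) = b - a.
Proof.
rewrite [b <= a.+1]leq_eqVlt ltnS => /andP[ab /predU1P[->|ba]].
  rewrite subSnn big_bool /=; have := congr1 odd (g_adj a); rewrite odd_hamming.
  by case: (odd _) (odd _) (nth _ _ _) (nth _ _ _) => [] [] [] [].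
have -> : a = b by lia.
by rewrite subnn big1 // => c _; rewrite eqxx.
Qed.

Lemma pos_periodic t : pos (t + M * 2 ^ m.+1) =1 pos t.
Proof.
by move=> q; rewrite /pos addnAC addnC [_ * 2 ^ _]mulnC divnMDl // addnC g_per.
Qed.

Lemma divn_window s i j : i <= M ->
  (s + j) %/ M <= (s + i + j) %/ M <= ((s + j) %/ M).+1.
Proof.
move=> iM; rewrite leq_div2r ?leq_add2r ?leq_addr //=.
by rewrite -divnDd // leq_div2r // addnAC leq_add2l.
Qed.

(** Within M steps each block advances at most once, at the cost of one coordinate; by Hermite's
    identity the number of advances is i. *)
Lemma hamming_pos_window s i : i <= M -> hamming (pos s) (pos (s + i)) = i.
Proof.
move=> iM; pose D j := (s + i + j) %/ M - (s + j) %/ M.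
have -> : hamming (pos s) (pos (s + i)) = \sum_(j < M) D j.
  rewrite /hamming big_sumType big_ord_recl; congr addn.
    rewrite -[LHS]/(hamming (g ((s + 0) %/ M)) (g ((s + i + 0) %/ M))) /D.
    exact/hamming_gray_window/divn_window.
  transitivity (\sum_(o < L) \sum_(b : bool)
      (pos s (inr (o, b)) != pos (s + i) (inr (o, b)))).
    by rewrite pair_bigA; apply: eq_bigr => -[].
  by apply: eq_bigr => o _; rewrite lift0; exact: feature_window (divn_window s o.+1 iM).
have := sum_divnD (s + i) M_gt0; rewrite -[in RHS](sum_divnD s M_gt0).
have -> : \sum_(j < M) (s + i + j) %/ M = \sum_(j < M) D j + \sum_(j < M) (s + j) %/ M.
  rewrite -big_split; apply: eq_bigr => j _ /=; rewrite subnK //.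
  by have /andP[] := divn_window s j iM.
lia.
Qed.

Lemma hamming_pos_far s t : s + M <= t -> t + M <= s + M * 2 ^ m.+1 ->
  k <= hamming (pos s) (pos t).
Proof.
move=> st ts; pose a j := (s + j) %/ M; pose b j := (t + j) %/ M.
pose G := k * l.
have a_mono i j : i <= j -> a i <= a j by move=> ij; rewrite leq_div2r ?leq_add2l.
have b_mono i j : i <= j -> b i <= b j by move=> ij; rewrite leq_div2r ?leq_add2l.
have a_jump : a (3 * G) <= (a 0).+1.
  by rewrite /a -divnDd // leq_div2r // addn0 leq_add2l.
have b_jump : b (3 * G) <= (b 0).+1.
  by rewrite /b -divnDd // leq_div2r // addn0 leq_add2l.
(* In every block the later time is ahead, but by less than a Gray period, so the two vertices shown
   differ. *)
have ab j : a j < b j < a j + 2 ^ m.+1.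
  have far : (t + j) %/ M + 1 <= a j + 2 ^ m.+1.
    rewrite addn1 -divnDd // [a j + _]addnC -(divnMDl _ _ M_gt0) leq_div2r //; lia.
  have : (a j).+1 <= b j by rewrite -divnDd // leq_div2r //; lia.
  by rewrite /b; lia.
(* [a] and [b] jump at most once each, so one of three groups sees no jump. *)
have [p p3 [ap bp]] : exists2 p, p < 3 &
    a (p * G).+1 = a (p.+1 * G) /\ b (p * G).+1 = b (p.+1 * G).
  have G_gt0 : 0 < G by rewrite muln_gt0 k_gt0.
  have [a01 b01] := (a_mono 0 1 isT, b_mono 0 1 isT).
  have [a1 b1] := (a_mono 1 G G_gt0, b_mono 1 G G_gt0).
  have [a2 b2] := (a_mono _ _ (leqnSn G), b_mono _ _ (leqnSn G)).
  have G2 : G.+1 <= 2 * G by lia.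
  have [a3 b3] := (a_mono _ _ G2, b_mono _ _ G2).
  have [a4 b4] := (a_mono _ _ (leqnSn (2 * G)), b_mono _ _ (leqnSn (2 * G))).
  have G3 : (2 * G).+1 <= 3 * G by lia.
  have [a5 b5] := (a_mono _ _ G3, b_mono _ _ G3).
  have [E|N1] := boolP ((a 1 == a G) && (b 1 == b G)).
    by exists 0 => //; rewrite mul0n mul1n; lia.
  have [E|N2] := boolP ((a G.+1 == a (2 * G)) && (b G.+1 == b (2 * G))).
    by exists 1 => //; rewrite mul1n; lia.
  by exists 2 => //; lia.
(* Group p consists of the blocks p * G + 1 to (p + 1) * G; the shift by one is due to block 0,
   which holds the vertex itself. *)
have stable j : p * G < j <= p.+1 * G -> a j = a (p.+1 * G) /\ b j = b (p.+1 * G).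
  move=> /andP[lo hi].
  have := (a_mono _ _ lo, a_mono _ _ hi, b_mono _ _ lo, b_mono _ _ hi).
  by rewrite ap bp => -[[[]]]; lia.
pose u := g (a (p.+1 * G)); pose v := g (b (p.+1 * G)).
have uv : u != v by apply/g_inj/ab.
have [close|far] := leqP (hamming u v) k.+1.
  have /existsP[c chic] : [exists c, tnth (chi u) c != tnth (chi v) c].
    apply: contraNT (chiP uv close) => /existsPn same.
    by apply/eqP/eq_from_tnth => c; have := same c; rewrite negbK => /eqP.
  have cl := ltn_ord c.
  (* The index of the r-th copy of color bit c in group p: p * k copies of the color precede the
     group. *)
  have lt_L (r : 'I_k) : (p * k + r) * l + c < L.
    have : r.+1 * l <= k * l by rewrite leq_mul2r ltn_ord orbT.
    have : p * G <= 2 * G by rewrite leq_mul2r -ltnS p3 orbT.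
    rewrite /G; lia.
  (* The untwisted members are taken, so that parity cannot cancel the difference in color. *)
  pose h r : Q := inr (Ordinal (lt_L r), false).
  apply: (@leq_hamming_inj _ _ h) => [r r' [/eqP]|r].
    by rewrite eqn_add2r eqn_pmul2r // eqn_add2l => /eqP/val_inj.
  have : p * G < ((p * k + r) * l + c).+1 <= p.+1 * G.
    have : r.+1 * l <= k * l by rewrite leq_mul2r ltn_ord orbT.
    rewrite /G; lia.
  case/stable => Ea Eb.
  by rewrite /pos /= -/(a _) -/(b _) Ea Eb !addbF modnMDl modn_small // -!tnth_nth.
(* Now [u] and [v] are at distance at least k + 2, and block 0 is at most one Gray step behind the
   group at either time, which leaves k. *)
have uk : hamming (g (a 0)) u <= 1.
  have := a_mono 0 (p.+1 * G) isT.
  have : p.+1 * G <= 3 * G by rewrite leq_mul2r p3 orbT.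
  move/a_mono => ? ?; rewrite /u hamming_gray_window; lia.
have vk : hamming (g (b 0)) v <= 1.
  have := b_mono 0 (p.+1 * G) isT.
  have : p.+1 * G <= 3 * G by rewrite leq_mul2r p3 orbT.
  move/b_mono => ? ?; rewrite /v hamming_gray_window; lia.
have kx : k <= hamming (g (a 0)) (g (b 0)).
  have := hamming_triangle (g (a 0)) u v.
  have := hamming_triangle (g (b 0)) (g (a 0)) v.
  by rewrite (hammingC u (g _)); lia.
by apply: leq_trans kx _; rewrite /hamming [leqRHS]big_sumType leq_addr.
Qed.

Lemma hamming_pos s i : i <= M * 2 ^ m.+1 ->
  minn (minn i (M * 2 ^ m.+1 - i)) k <= hamming (pos s) (pos (s + i)).
Proof.
move=> iN; set N := M * 2 ^ m.+1 in iN *.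
have [iM|Mi] := leqP i M; first by rewrite hamming_pos_window //; lia.
have [NiM|MNi] := leqP (N - i) M.
  (* The other arc is short: N - i steps lead from s + i to s + N, where the period closes. *)
  have -> : hamming (pos s) (pos (s + i)) = N - i.
    rewrite hammingC -(hamming_pos_window (s + i) NiM) -addnA subnKC //.
    by apply: eq_bigr => q _; rewrite pos_periodic.
  lia.
by apply: leq_trans (geq_minr _ _) (hamming_pos_far _ _); lia.
Qed.

End Construction.

Lemma leq_K_construction (m k l : nat) : 0 < k -> m.+2 ^ k.+1 <= 2 ^ l ->
  2 ^ m.+1 <= K (m.+1 + 6 * (k * l)) k.
Proof.
move=> k_gt0 colors.
have l_gt0 : 0 < l.
  by case: l colors => //; rewrite expn0 leqNgt -[X in X < _](exp1n k.+1) ltn_exp2r.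
have [g [g_per g_inj g_adj]] := gray_cycle m.
pose X := {ffun 'I_m.+1 -> bool}.
pose conflict : rel X := fun x y => (x != y) && (hamming x y <= k.+1).
have [] := @greedy_coloring X (l.-tuple bool) conflict.
- by move=> x y; rewrite /conflict eq_sym hammingC.
- by move=> x; rewrite /conflict eqxx.
(* The conflicts of [x] lie in its ball of radius k + 1 but omit [x], which makes the degree bound
   strict. *)
- move=> x; rewrite card_tuple card_bool.
  apply: leq_trans colors; apply: leq_trans (leq_card_ball k.+1 x).
  apply/proper_card/fintype.properP; split.
    by apply/fintype.subsetP => y; rewrite !inE => /andP[].
  by exists x; rewrite !inE ?hammingxx // /conflict eqxx.
move=> chi chiE.
have chiP (x y : X) : x != y -> hamming x y <= k.+1 -> chi x != chi y.
  by move=> xy xyk; apply: chiE; rewrite /conflict xy.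
pose L := 3 * (k * l).
have kl_gt0 : 0 < k * l by rewrite muln_gt0 k_gt0.
have -> : m.+1 + 6 * (k * l) = #|{: 'I_m.+1 + 'I_L * bool}|.
  by rewrite card_sum card_prod !card_ord card_bool /L; lia.
(* The circuit has [L.+1 * 2 ^ m.+1] vertices; the factor [L.+1] is given up. *)
apply: (@leq_trans (L.+1 * 2 ^ m.+1)); first by rewrite leq_pmull.
apply: (leq_K (pos := @pos m k l g chi)) => //.
- by rewrite expnS; have := expn_gt0 2 m; rewrite /L; nia.
- exact: pos_periodic.
- by move=> t; rewrite -(addn1 t) hamming_pos_window.
- exact: hamming_pos.
Qed.

(** * Bounds on [K] for a given dimension *)

Lemma K_upper d k : K d k <= 2 ^ d.
Proof.
apply/bigmax_leqP => n _; rewrite -ltnS.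
by have -> : 2 ^ d = #|cube d| by rewrite card_tuple card_bool.
Qed.

(** The 6kl coordinates spent on pairs, with l chosen so that 2 ^ l exceeds d ^ (k + 1) and the
    colors suffice. *)
Definition redundancy (k d : nat) : nat := 6 * (k * (k.+1 * (trunc_log 2 d).+1)).

Lemma K_lower d k : 0 < k -> redundancy k d < d -> 2 ^ (d - redundancy k d) <= K d k.
Proof.
move=> k_gt0 rd; set l := k.+1 * (trunc_log 2 d).+1.
(* The Gray code is taken in the dimension that remains after the pairs. *)
have dE : d = (d - redundancy k d).-1.+1 + 6 * (k * l).
  by rewrite prednK ?subn_gt0 // subnK // ltnW.
rewrite [in leqRHS]dE -{1}[d - _]prednK ?subn_gt0 //.
apply: leq_K_construction => //.
rewrite /l mulnC expnM leq_exp2r // prednK ?subn_gt0 //.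
have := trunc_log_ltn d (isT : 1 < 2); apply: leq_trans.
by rewrite ltnS leq_subr.
Qed.

Local Open Scope ring_scope.
Local Open Scope classical_set_scope.

(** * Asymptotics of [log2 (K d k)] *)

Section Asymptotics.
Variables (R : realType) (k : nat).
Hypothesis k_gt0 : (0 < k)%N.

Lemma ln_nat_ge0 (n : nat) : 0 <= ln (n%:R : R).
Proof. by case: n => [|n]; [rewrite ln0|rewrite ln_ge0 // ler1n]. Qed.

Lemma log2_exp (n : nat) : log2 ((2 ^ n)%N%:R : R) = n%:R.
Proof.
by rewrite /log2 natrX lnXn // mulrnAl divff // gt_eqF // ln_gt0 // ltr1n.
Qed.

Lemma log2_le (m n : nat) : (0 < m)%N -> (m <= n)%N ->
  log2 (m%:R : R) <= log2 (n%:R : R).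
Proof.
move=> m0 mn; rewrite ler_pM2r ?invr_gt0 ?ln_gt0 ?ltr1n //.
by rewrite ler_ln ?posrE ?ltr0n ?ler_nat // (leq_trans m0).
Qed.

Lemma log2_K_bounds (d : nat) :
  `|log2 ((K d k)%:R : R) - d%:R| <= (redundancy k d)%:R.
Proof.
have log2_ge0 : 0 <= log2 ((K d k)%:R : R).
  by rewrite divr_ge0 ?ln_nat_ge0.
rewrite ler_norml; apply/andP; split.
  have [rd|dr] := ltnP (redundancy k d) d.
    rewrite lerBrDl -natrB ?(ltnW rd) // -(log2_exp (d - _)%N).
    by apply: log2_le; rewrite ?expn_gt0 // K_lower.
  by rewrite lerBrDl (le_trans _ log2_ge0) // subr_le0 ler_nat.
(* Without any circuit code [K] is 0, and the convention [ln 0 = 0] makes its logarithm 0. *)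
have [->|Kn0] := posnP (K d k).
  by rewrite /log2 ln0 // mul0r sub0r (le_trans _ (ler0n _ _)) // oppr_le0 ler0n.
apply: (@le_trans _ _ 0) => //.
by rewrite subr_le0 -(log2_exp d) log2_le // K_upper.
Qed.

Lemma redundancy_le : exists2 C : R, 0 < C &
  \forall d \near \oo, 1 <= ln (d%:R : R) /\ (redundancy k d)%:R <= C * ln (d%:R : R).
Proof.
have ln2 : 0 < ln (2 : R) by rewrite ln_gt0 // ltr1n.
(* The truncated logarithm is at most ln d / ln 2, and the added 1 is at most ln d once d >= e. *)
exists ((6 * (k * k.+1))%N%:R * ((ln 2)^-1 + 1)).
  by rewrite mulr_gt0 ?addr_gt0 ?invr_gt0 // ltr0n !muln_gt0 k_gt0.
near=> d.
have ed : expR 1 <= d%:R :> R by near: d; exact: nbhs_infty_ger.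
have d0 : 0 < d%:R :> R := lt_le_trans (expR_gt0 _) ed.
have d_gt0 : (0 < d)%N by rewrite -(ltr0n R).
have ln1 : 1 <= ln (d%:R : R) by rewrite -[leLHS]expRK ler_ln ?posrE ?expR_gt0.
split=> //; rewrite /redundancy !mulnA natrM -!mulrA ler_wpM2l //.
rewrite mulrDl mul1r -addn1 natrD lerD //.
rewrite mulrC ler_pdivlMr // mulr_natl -lnXn // -natrX ler_ln ?posrE ?ltr0n ?expn_gt0 //.
by rewrite ler_nat trunc_logP.
Unshelve. all: by end_near. Qed.

(** From ln y < y at the square root of x; it makes ln d negligible against d. *)
Lemma ln_le_sqrt (x : R) : 0 < x -> ln x <= 2 * Num.sqrt x.
Proof.
move=> x0; rewrite -{1}(sqr_sqrtr (ltW x0)) lnXn ?sqrtr_gt0 // [leRHS]mulr_natl lerMn2r.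
by rewrite ltW ?orbT // ln_sublinear // sqrtr_gt0.
Qed.

Lemma cvg_log2_K : (fun d : nat => log2 (K d k)%:R / d%:R : R) @ \oo --> (1 : R).
Proof.
have [C C0 CP] := redundancy_le.
apply/cvgrPdist_le => e e0; near=> d.
have [ln1 rC] : 1 <= ln (d%:R : R) /\ (redundancy k d)%:R <= C * ln (d%:R : R).
  by near: d.
(* Beyond this threshold 2 C sqrt d <= e d. *)
have de : (2 * C / e) ^+ 2 <= d%:R by near: d; exact: nbhs_infty_ger.
have d0 : 0 < d%:R :> R.
  by rewrite (lt_le_trans _ de) // exprn_gt0 // divr_gt0 // mulr_gt0.
rewrite -[X in `|X - _|](divff (lt0r_neq0 d0)) -mulrBl normrM normfV (gtr0_norm d0).
rewrite ler_pdivrMr // distrC (le_trans (log2_K_bounds d)) // (le_trans rC) //.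
rewrite (le_trans (ler_wpM2l (ltW C0) (ln_le_sqrt d0))) //.
rewrite -[X in _ <= _ * X](sqr_sqrtr (ltW d0)) expr2 !mulrA ler_wpM2r ?sqrtr_ge0 //.
have: Num.sqrt ((2 * C / e) ^+ 2) <= Num.sqrt (d%:R : R) by rewrite ler_sqrt // ltW.
rewrite sqrtr_sqr ger0_norm ?divr_ge0 ?mulr_ge0 ?(ltW C0) ?(ltW e0) //.
by rewrite ler_pdivrMr // [_ * C]mulrC [_ * e]mulrC.
Unshelve. all: by end_near. Qed.

End Asymptotics.

Theorem theorem1 (R : realType) (k : nat) (hk : (1 <= k)%N) :
  ((fun d : nat => log2 (K d k)%:R : R^o)
     = (fun d : nat => d%:R : R^o) +O_\oo (fun d : nat => ln d%:R ^+ 2 : R^o))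
  /\ cvgn (fun d : nat => log2 (K d k)%:R / d%:R : R)
  /\ nu R k = 1.
Proof.
split; last by split; [apply: cvgP|apply: cvg_lim => //]; apply: cvg_log2_K.
apply/eqaddOP/bigO_exP; have [C C0 CP] := redundancy_le R hk; exists C => //.
near=> d.
have [ln1 rC] : 1 <= ln (d%:R : R) /\ (redundancy k d)%:R <= C * ln (d%:R : R).
  by near: d.
rewrite (le_trans (log2_K_bounds R hk d)) // (le_trans rC) //.
(* The error is at most C ln d, and ln d is at most its square because [1 <= ln d]. *)
rewrite ler_wpM2l ?(ltW C0) // (le_trans _ (ler_norm _)) // expr2.
by rewrite ler_peMl // (le_trans ler01).
Unshelve. all: by end_near. Qed.
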